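(* Let $n\ge2$, $1\le r<n$, $X_\star\in\mathbb R^{n\times n}$, $0<q\le1$, $\tau>0$. Suppose that $\operatorname{rank}(Z)\le r$ and $|\Lambda|=m$, where $Z\in\mathbb R^{n\times n}$ and $\Lambda\subseteq\{1,\dots,n\}^2$. Then $$\mathcal T_\tau\big(Z+q^{-1}\mathcal P_\Lambda(X_\star-Z)\big)$$ can be computed in matrix-free form using $O\big((mr+nr^2)\log n\big)$ operations. Evaluating the observed residual $q^{-1/2}\|\mathcal P_\Lambda(X_\star-Z)\|_{\mathrm F}$ costs $O(mr)$ additional operations.
   Context: $\mathcal P_\Lambda$ keeps the entries indexed by $\Lambda$ and sets the others to zero; the available data are $\mathcal P_\Lambda(X_\star)$. Matrix-free form: $Z$ is given by a factorization $Z=U\Sigma V^T$ with at most $r$ columns in $U,V$, the sparse matrix is given by its at most $m$ nonzero entries, and the result is returned in factored form; operations are arithmetic operations, and $O(\cdot)$ hides an absolute constant. $\log$ is the natural logarithm. **Operator $\mathcal T_\tau$.** For an SVD $Y=\sum_j\sigma_ju_jv_j^T$, let $\mathcal H_{\ge\lambda}(Y)=\sum_{\sigma_j\ge\lambda}\sigma_ju_jv_j^T$. Let $\operatorname{qf}$ denote the orthogonal factor of a thin QR factorization. For $\tau>0$ and $Y\in\mathbb R^{n\times n}$: let $G\in\mathbb R^{n\times r}$ have i.i.d. standard Gaussian entries, put $Q_0=\operatorname{qf}(G)$, and $Q_{t+1}=\operatorname{qf}\big(Y(Y^TQ_t)+\tfrac{\tau^2}{4096}Q_t\big)$ for $0\le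 t<\lceil12\log n\rceil$; with $Q$ the final factor, $\mathcal T_\tau(Y)=Q\,\mathcal H_{\ge\tau/8}(Q^TY)$.
   Formalization: Since an exact SVD cannot be computed by finitely many arithmetic operations and square roots, operations here also include square roots, comparisons, random draws, and an exact SVD of a k×k matrix, charged k³ operations. *)

(* Defs.v *)
From HB Require Import structures.
From mathcomp Require Import all_boot all_order all_algebra.
From mathcomp Require Import all_classical all_reals all_analysis.

Set Implicit Arguments.
Unset Strict Implicit.
Unset Printing Implicit Defensive.

Import Order.TTheory GRing.Theory Num.Theory.
Import numFieldNormedType.Exports.

Local Open Scope classical_set_scope.
Local Open Scope ring_scope.

Section LinearAlgebra.
Context {R : realType}.

Definition proj_entries n (Lam : {set 'I_n * 'I_n}) (X : 'M[R]_n) : 'M[R]_n :=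
  \matrix_(i, j) (if (i, j) \in Lam then X i j else 0).

(* The norm of the library on matrices is the maximum norm. *)
Definition frobenius p q (A : 'M[R]_(p, q)) : R :=
  Num.sqrt (\sum_i \sum_j A i j ^+ 2).

(* A = sum_j s_j u_j v_j^T with u_j, v_j the columns of U, V. The number k of
   triples is free (thin and compact SVDs are both allowed) and the singular
   values need not be sorted. *)
Definition is_svd p q k (A : 'M[R]_(p, q))
    (U : 'M[R]_(p, k)) (s : 'rV[R]_k) (V : 'M[R]_(q, k)) : Prop :=
  [/\ U^T *m U = 1%:M, V^T *m V = 1%:M, (forall j, 0 <= s 0 j)
    & A = U *m diag_mx s *m V^T].

(* B = H_{>= lam}(A). For lam > 0 the value B does not depend on the SVD. *)
Definition is_hard_threshold p q (lam : R) (A B : 'M[R]_(p, q)) : Prop :=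
  exists k (U : 'M[R]_(p, k)) (s : 'rV[R]_k) (V : 'M[R]_(q, k)),
    is_svd A U s V /\
    B = \sum_(j < k | lam <= s 0 j) s 0 j *: (col j U *m (col j V)^T).

(* Q is the orthogonal factor of a thin QR factorization of A. It is a relation
   because the factor is determined by A only up to the signs of its columns
   (and has more freedom when A is rank deficient). *)
Definition is_qf n r (A Q : 'M[R]_(n, r)) : Prop :=
  Q^T *m Q = 1%:M /\
  exists T : 'M[R]_r, (forall i j : 'I_r, (j < i)%N -> T i j = 0) /\ A = Q *m T.

Definition num_iter (n : nat) : nat := `|Num.ceil (12 * ln (n%:R : R))|%N.

(* B is a value of the randomized operator T_tau at Y when the Gaussian test
   matrix takes the value G. If G has full column rank (almost surely), every
   choice of QR factors spans the same subspaces, so B is unique. *)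
Definition is_T n r (tau : R) (G : 'M[R]_(n, r)) (Y B : 'M[R]_n) : Prop :=
  exists Q : nat -> 'M[R]_(n, r),
    [/\ is_qf G (Q 0%N),
        forall t, (t < num_iter n)%N ->
          is_qf (Y *m (Y^T *m Q t) + (tau ^+ 2 / 4096) *: Q t) (Q t.+1)
      & exists H : 'M[R]_(r, n),
          is_hard_threshold (tau / 8) ((Q (num_iter n))^T *m Y) H /\
          B = Q (num_iter n) *m H].

(* Taking some of the B i j to be setT gives the independence of every
   subfamily of the entries and the N(0, 1) law of each entry. *)
Definition iid_std_gaussian d (Om : measurableType d) (P : probability Om R)
    n r (G : Om -> 'M[R]_(n, r)) : Prop :=
  (forall i j, measurable_fun setT (fun w => G w i j)) /\
  forall B : 'I_n -> 'I_r -> set R, (forall i j, measurable (B i j)) ->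
    P [set w | forall i j, B i j (G w i j)] =
    (\prod_(i < n) \prod_(j < r) normal_prob (0 : R) 1 (B i j))%E.

End LinearAlgebra.

(* Arithmetic complexity is measured on straight-line programs over the reals.
   A program is a list of instructions; each one appends its result(s) to the
   list of registers, and operands are positions in that list. I names the
   real inputs, W the random numbers that can be drawn. *)
Inductive instr (I W : Type) : Type :=
| Input of I
| Draw of W
| Const of rat
| Add of nat & nat
| Sub of nat & nat
| Mul of nat & nat
| Div of nat & nat
| Sqrt of nat
| Select of nat & nat & nat & nat
| Svd (k : nat) of ('I_k -> 'I_k -> nat).

Arguments Input {I W}.
Arguments Draw {I W}.
Arguments Const {I W}.
Arguments Add {I W}.
Arguments Sub {I W}.
Arguments Mul {I W}.
Arguments Div {I W}.
Arguments Sqrt {I W}.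
Arguments Select {I W}.
Arguments Svd {I W}.

Definition program (I W : Type) := seq (instr I W).

(* A dense k x k SVD is charged k^3 operations, the usual convention of
   numerical linear algebra: it cannot be computed exactly with finitely many
   field operations, square roots and comparisons. Everything else, in
   particular QR and the SVD of rectangular matrices, has to be programmed. *)
Definition instr_cost I W (c : instr I W) : nat :=
  match c with
  | Input _ | Const _ => 0%N
  | Svd k _ => (k ^ 3)%N
  | _ => 1%N
  end.

Definition cost I W (p : program I W) : nat := (\sum_(c <- p) instr_cost c)%N.

Section Semantics.
Context {R : realType}.

Definition svd_fun := forall k, 'M[R]_k -> 'M[R]_k * 'rV[R]_k * 'M[R]_k.

Definition svd_correct (svd : svd_fun) : Prop :=
  forall k (A : 'M[R]_k), is_svd A (svd k A).1.1 (svd k A).1.2 (svd k A).2.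

Definition entries p q (A : 'M[R]_(p, q)) : seq R :=
  [seq mxvec A 0 l | l <- enum 'I_(p * q)].

Context {I W : Type} (svd : svd_fun) (input : I -> R) (sample : W -> R).

(* Division by zero and square roots of negative numbers follow the library
   conventions x / 0 = 0 and sqrt x = 0; Select simulates any other convention
   with a constant number of operations. *)
Definition step (rs : seq R) (c : instr I W) : seq R :=
  rs ++ match c with
  | Input x => [:: input x]
  | Draw w => [:: sample w]
  | Const a => [:: ratr a]
  | Add a b => [:: rs`_a + rs`_b]
  | Sub a b => [:: rs`_a - rs`_b]
  | Mul a b => [:: rs`_a * rs`_b]
  | Div a b => [:: rs`_a / rs`_b]
  | Sqrt a => [:: Num.sqrt rs`_a]
  | Select a b x y => [:: if rs`_a <= rs`_b then rs`_x else rs`_y]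
  | Svd k A =>
      let: (U, s, V) := svd (\matrix_(i, j) rs`_(A i j)) in
      entries U ++ entries s ++ entries V
  end.

Definition run (p : program I W) : seq R := foldl step [::] p.

End Semantics.

(* The real inputs: q, tau, the factors U (n x k), Sigma (k diagonal entries)
   and V (n x k) of Z, and the m observed entries of X. *)
Inductive data_index (n k m : nat) : Type :=
| DataQ
| DataTau
| DataU of 'I_n & 'I_k
| DataS of 'I_k
| DataV of 'I_n & 'I_k
| DataX of 'I_m.

Definition data {R : realType} n k (Lam : {set 'I_n * 'I_n}) (q tau : R)
    (U : 'M[R]_(n, k)) (s : 'rV[R]_k) (V : 'M[R]_(n, k)) (X : 'M[R]_n)
    (x : data_index n k #|Lam|) : R :=
  match x with
  | DataQ => q
  | DataTau => tau
  | DataU i l => U i l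
  | DataS l => s 0 l
  | DataV i l => V i l
  | DataX e => X (enum_val e).1 (enum_val e).2
  end.

(* Where a program leaves the factors of an n x n matrix U Sigma V^T with at
   most r columns in U and V. *)
Record factored_regs (n r : nat) := FactoredRegs {
  fr_cols : nat;
  fr_cols_le : (fr_cols <= r)%N;
  fr_U : 'I_n -> 'I_fr_cols -> nat;
  fr_S : 'I_fr_cols -> nat;
  fr_V : 'I_n -> 'I_fr_cols -> nat }.

Arguments fr_U {n r} f _ _.
Arguments fr_S {n r} f _.
Arguments fr_V {n r} f _ _.

Definition factored_value {R : realType} n r (f : factored_regs n r)
    (rs : seq R) : 'M[R]_n :=
  (\matrix_(i, l) rs`_(fr_U f i l)) *m diag_mx (\row_l rs`_(fr_S f l)) *m
  (\matrix_(i, l) rs`_(fr_V f i l))^T.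

(* Main.v *)
(* The corrected matrix Y is low rank plus sparse, so Y Q and Y^T Q cost
   O(n r^2 + m r) for an n x r block Q, and a thin QR factorization by
   Gram-Schmidt costs O(n r^2); hence the bound for the O(log n) power steps.
   For the last step let M = Q^T Y and M^T = W T a thin QR factorization. If
   A S B^T is an SVD of the r x r matrix (W^T M^T)^T, then A S (W B)^T is an SVD
   of M, and the factors of the result are Q A, the thresholded S, and W B. *)

(* The claim covers every outcome of the test matrix, including those where it or a power iterate is
   rank deficient, so the QR step has to be total. A straight-line program moreover cannot branch on
   data: the rank test and the choice of a replacement column are made by [Select] and arithmetic
   that is always executed, within O(n r) operations per column. For the same reason discarded
   singular values are zeroed instead of removed. Whatever depends only on [Lam], n, r and k is
   settled while the code is generated and costs nothing. Each algorithm appears twice, as a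
   function on matrices and as code. The code is shown to compute the function, and only the
   function is compared with [is_T]. The initial QR and the final SVD are absorbed by the factor log
   n because n >= 2 keeps it away from 0. *)
Require Import Defs.
From mathcomp Require Import all_boot all_order all_algebra.
From mathcomp Require Import all_classical all_reals all_analysis.
From mathcomp Require Import zify lra.

Set Implicit Arguments.
Unset Strict Implicit.
Unset Printing Implicit Defensive.

Import Order.TTheory GRing.Theory Num.Theory.
Import numFieldNormedType.Exports.

Local Open Scope ring_scope.

(** * Gram-Schmidt with a fallback for dependent columns *)

Section GramSchmidt.
Context {R : realType} {n r : nat}.
Implicit Types (Q A : 'M[R]_(n, r)) (x : 'cV[R]_n).

(* The columns of Q that are not computed yet are 0, so this projects along the
   computed ones although all r columns are used. *)
Definition oproj Q x : 'cV[R]_n := x - Q *m (Q^T *m x).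

Definition sqnorm x : R := \sum_i x i 0 ^+ 2.

(* The i-th diagonal entry of the orthogonal projector 1 - Q Q^T. *)
Definition leftover Q (i : 'I_n) : R := 1 - \sum_l Q i l ^+ 2.

(* A unit vector e_i as a branch-free recursion: found is 1 from the first
   positive c i on, and c <= 1 then blocks every later choice. *)
Fixpoint first_pos (c : 'I_n -> R) (s : seq 'I_n) (found : R) (i : 'I_n) : R :=
  if s is i0 :: s' then
    let b := if c i0 <= found then 0 else 1 in
    if i == i0 then b else first_pos c s' (found + b) i
  else 0.

Definition fallback Q : 'cV[R]_n :=
  \col_i first_pos (leftover Q) (enum 'I_n) 0 i.

(* A column that depends on the previous ones leaves the residual 0 and is
   replaced by a basis vector outside their span, as G may be rank deficient. *)
Definition candidate A Q j : 'cV[R]_n :=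
  if sqnorm (oproj Q (col j A)) <= 0 then fallback Q else col j A.

Definition gs_step A Q j : 'M[R]_(n, r) :=
  let y := oproj Q (candidate A Q j) in
  \matrix_(i, l) if l == j then y i 0 / Num.sqrt (sqnorm y) else Q i l.

Definition gram_schmidt A : 'M[R]_(n, r) := foldl (gs_step A) 0 (enum 'I_r).

Lemma sqnormE x : x^T *m x = (sqnorm x)%:M.
Proof.
apply/matrixP=> i j; rewrite !ord1 !mxE eqxx mulr1n.
by apply: eq_bigr => l _; rewrite mxE expr2.
Qed.

Lemma sqnorm_ge0 x : 0 <= sqnorm x.
Proof. by apply: sumr_ge0 => i _; apply: sqr_ge0. Qed.

Lemma sqnorm_eq0 x : sqnorm x = 0 -> x = 0.
Proof.
move=> /psumr_eq0P x0; apply/matrixP => i j; rewrite ord1 mxE; apply/eqP.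
by rewrite -sqrf_eq0; apply/eqP/x0 => // l _; apply: sqr_ge0.
Qed.

Lemma first_pos_found (c : 'I_n -> R) s i :
  (forall i, c i <= 1) -> first_pos c s 1 i = 0.
Proof.
move=> c_le; elim: s => //= i0 s IHs; rewrite c_le addr0.
by case: eqP.
Qed.

Lemma first_posP (c : 'I_n -> R) s :
  (forall i, c i <= 1) -> (exists2 i, i \in s & 0 < c i) ->
  exists2 i0, 0 < c i0 & forall i, first_pos c s 0 i = (i == i0)%:R.
Proof.
move=> c_le; elim: s => [|i0 s IHs] [i]; first by rewrite in_nil.
rewrite inE /=; case: (lerP (c i0) 0) => [c0|c0 _ _]; last first.
  exists i0 => // l; case: eqP => //= _.
  by rewrite add0r first_pos_found.
case: eqP => [-> _|_ /= i_s] ci; first by rewrite ltNge c0 in ci.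
have [|i1 ci1 Ei1] := IHs; first by exists i.
exists i1 => // l; rewrite addr0; case: eqP => // ->.
by case: eqP ci1 => // <-; rewrite ltNge c0.
Qed.

(** The invariant after the columns in [s] are processed. Zero columns for the others let one Gram
    identity serve at every stage. The triangular factor is recorded column by column, so no partial
    matrix has to be extended. *)
Definition gs_inv A (s : seq 'I_r) Q : Prop :=
  [/\ Q^T *m Q = diag_mx (\row_l (l \in s)%:R),
      forall i l, l \notin s -> Q i l = 0
    & forall l, l \in s -> exists2 t : 'cV[R]_r,
        col l A = Q *m t & forall i : 'I_r, (l < i)%N -> t i 0 = 0].

(** The zeros of the 0/1 diagonal [Q^T *m Q] sit at zero columns of [Q]. Hence [Q *m Q^T] is an
    orthogonal projector even before all columns are known. *)
Lemma gs_inv_mulD A s Q : gs_inv A s Q -> Q *m (Q^T *m Q) = Q.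
Proof.
case=> -> Q0 _; apply/matrixP=> i l; rewrite mul_mx_diag !mxE.
by case: (boolP (l \in s)) => [_|/Q0->]; rewrite ?mulr1 ?mul0r.
Qed.

Lemma gs_inv_oproj A s Q x : gs_inv A s Q -> Q^T *m oproj Q x = 0.
Proof.
move=> /gs_inv_mulD QD; rewrite mulmxBr !mulmxA -{1}QD !trmx_mul trmxK.
by rewrite ?mulmxA subrr.
Qed.

(** A trace argument: the leftovers sum to n minus the number of computed columns, which is less
    than r <= n because column [j] is missing. *)
Lemma leftover_gt0 A s j Q :
  (r <= n)%N -> gs_inv A s Q -> j \notin s -> exists i, 0 < leftover Q i.
Proof.
move=> le_rn [QQ _ _] j_s; apply/existsP; apply: contraT.
rewrite negb_exists => /forallP le0.
have : \sum_i leftover Q i <= 0.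
  by apply: sumr_le0 => i _; rewrite leNgt; apply: le0.
rewrite leNgt => /negP[]; rewrite /leftover sumrB exchange_big /= subr_gt0.
have -> : \sum_(l < r) \sum_(i < n) Q i l ^+ 2 = \sum_(l < r) (l \in s)%:R.
  apply: eq_bigr => l _; have /matrixP/(_ l l) := QQ.
  rewrite !mxE eqxx mulr1n => <-.
  by apply: eq_bigr => i _; rewrite mxE expr2.
rewrite sumr_const card_ord -natr_sum ltr_nat (leq_trans _ le_rn) //.
rewrite (bigD1 j) //= (negbTE j_s) add0n -[ltnRHS]card_ord -sum1_card.
rewrite [X in (_ < X)%N](bigD1 j) //= add1n ltnS.
by apply: leq_sum => l _; apply: leq_b1.
Qed.

(** In the fallback case the candidate is a basis vector, and the entry of its residual at its own
    index is the positive leftover there. So the normalization never divides by zero. *)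
Lemma candidate_oproj_neq0 A s j Q :
  (r <= n)%N -> gs_inv A s Q -> j \notin s ->
  0 < sqnorm (oproj Q (candidate A Q j)).
Proof.
move=> le_rn QI j_s; rewrite /candidate.
case: ifPn => [_|]; last by rewrite -ltNge.
have [i ci] := leftover_gt0 le_rn QI j_s.
have c_le i1 : leftover Q i1 <= 1.
  by rewrite gerBl; apply: sumr_ge0 => l _; apply: sqr_ge0.
have [|i0 ci0 Ei0] := first_posP (s := enum 'I_n) c_le.
  by exists i; rewrite // mem_enum.
rewrite lt_neqAle sqnorm_ge0 andbT eq_sym; apply/eqP => /sqnorm_eq0 /matrixP.
move=> /(_ i0 0); rewrite /oproj.
have -> : fallback Q = delta_mx i0 0.
  by apply/matrixP=> l m; rewrite !mxE Ei0 ord1 eqxx andbT.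
rewrite mulmxA -colE !mxE !eqxx => /eqP; apply/negP; rewrite gt_eqF //.
by under eq_bigr do rewrite mxE -expr2.
Qed.

Lemma gs_stepP A s (j : 'I_r) Q :
  (r <= n)%N -> gs_inv A s Q -> (forall l, l \in s -> (l < j)%N) ->
  (forall l : 'I_r, (j < l)%N -> l \notin s) ->
  gs_inv A (rcons s j) (gs_step A Q j).
Proof.
move=> le_rn QI lt_s gt_s.
have j_s : j \notin s by apply/negP => /lt_s; rewrite ltnn.
have y_gt0 := candidate_oproj_neq0 le_rn QI j_s.
have [QQ Q0 Qspan] := QI.
set y := oproj _ _ in y_gt0; set Q' := gs_step _ _ _.
set u := (Num.sqrt (sqnorm y))^-1 *: y.
(* Column [j] of [Q] is still zero, so overwriting it is a rank-one update and products with [Q']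
   expand. *)
have Q'E : Q' = Q + u *m delta_mx 0 j.
  apply/matrixP=> i l; rewrite !mxE big_ord1 !mxE eqxx /= -/y.
  case: eqP => [->|_]; last by rewrite mulr0 addr0.
  by rewrite Q0 // add0r mulr1 mulrC.
have Qu : Q^T *m u = 0 by rewrite -scalemxAr (gs_inv_oproj _ QI) scaler0.
have uu : u^T *m u = 1%:M.
  have -> : u^T = (Num.sqrt (sqnorm y))^-1 *: y^T by rewrite linearZ.
  rewrite -scalemxAl -scalemxAr sqnormE scalerA -invfM -expr2.
  by rewrite sqr_sqrtr ?ltW // -mul_scalar_mx -scalar_mxM mulVf ?gt_eqF.
have uQ : u^T *m Q = 0 by rewrite -[u^T *m Q]trmxK trmx_mul trmxK Qu trmx0.
split=> [|i l|l].
- have -> : Q'^T = Q^T + delta_mx j 0 *m u^T.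
    by rewrite Q'E linearD /= trmx_mul trmx_delta.
  rewrite Q'E mulmxDl !mulmxDr QQ !mulmxA Qu mul0mx addr0.
  rewrite -[_ *m u^T *m Q]mulmxA uQ mulmx0 add0r -[_ *m u^T *m u]mulmxA uu.
  rewrite mulmx1 mul_delta_mx; apply/matrixP=> l m; rewrite !mxE.
  rewrite mem_rcons inE.
  have [->|lj] := eqVneq l j; last by rewrite addr0.
  by rewrite (negbTE j_s) mul0rn add0r eq_sym.
- rewrite mem_rcons inE negb_or => /andP[lj l_s].
  by rewrite mxE (negbTE lj) Q0.
rewrite mem_rcons inE; have [->|lj] := eqVneq l j => /= [_|l_s]; last first.
  (* The old coefficients survive: entry [j] of [t] is zero since l < j, so the new column does not
     contribute. *)
  have [t At t0] := Qspan l l_s; exists t => //.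
  rewrite At Q'E mulmxDl -mulmxA; suff -> : delta_mx 0 j *m t = 0 :> 'M[R]_1.
    by rewrite mulmx0 addr0.
  by rewrite -rowE; apply/matrixP=> i m; rewrite !mxE ord1 t0 // lt_s.
(* The diagonal coefficient is the norm of the residual of the original column. For a dependent
   column it is 0, so the fallback vector does not enter the factorization. *)
exists (Q^T *m col j A + Num.sqrt (sqnorm (oproj Q (col j A))) *: delta_mx j 0).
  rewrite mulmxDr Q'E !mulmxDl -!mulmxA.
  have -> : delta_mx 0 j *m (Q^T *m col j A) = 0 :> 'M[R]_1.
    rewrite -rowE; apply/matrixP=> i m; rewrite !mxE big1 // => l' _.
    by rewrite mxE Q0 ?mul0r.
  rewrite mulmx0 addr0 -!scalemxAr mul_delta_mx.
  have -> : Q *m delta_mx j 0 = 0 :> 'cV[R]_n.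
    by rewrite -colE; apply/matrixP=> i m; rewrite !mxE Q0.
  rewrite scaler0 add0r.
  have -> : delta_mx 0 0 = 1%:M :> 'M[R]_1.
    by apply/matrixP=> i m; rewrite !mxE !ord1.
  rewrite mulmx1; apply/eqP; rewrite addrC -subr_eq -/(oproj Q _); apply/eqP.
  rewrite /u /y /candidate; case: lerP => [le0|gt0].
    have /eqP eq0: sqnorm (oproj Q (col j A)) == 0.
      by rewrite eq_le le0 sqnorm_ge0.
    by rewrite eq0 sqrtr0 scale0r (sqnorm_eq0 eq0).
  by rewrite scalerA divff ?scale1r // sqrtr_eq0 -ltNge.
(* Triangularity: the columns of [Q] after [j] are still zero, hence so are the entries of
   [Q^T *m col j A] there. *)
move=> i ji; rewrite !mxE -val_eqE (gtn_eqF ji) mulr0 addr0 big1 // => l' _.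
by rewrite mxE Q0 ?mul0r // gt_s.
Qed.

Lemma gram_schmidtP A : (r <= n)%N -> is_qf A (gram_schmidt A).
Proof.
move=> le_rn; have I0 : gs_inv A [::] 0.
  split=> // [|i l _]; last by rewrite mxE.
  by rewrite mulmx0; apply/matrixP=> i j; rewrite !mxE mul0rn.
have sorted_enum : pairwise (fun l m : 'I_r => (l < m)%N) (enum 'I_r).
  by rewrite -(pairwise_map val ltn) val_enum_ord -sorted_pairwise
    ?iota_ltn_sorted //; apply: ltn_trans.
have {I0} [QQ _ QA] : gs_inv A (enum 'I_r) (gram_schmidt A).
  rewrite /gram_schmidt; have := erefl (enum 'I_r).
  rewrite -{1}[enum 'I_r]cat0s; move: (enum 'I_r) sorted_enum => e pair_e.
  (* Generalized to any split of the enumeration into processed columns [s] and remaining ones;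
     sortedness puts [s] below the next [j]. *)
  elim: {1 4}e [::] 0 I0 => [|j js IHjs] s Q I0; first by rewrite cats0 => <-.
  rewrite -cat_rcons => def_e; apply: IHjs (def_e).
  move: pair_e; rewrite -def_e cat_rcons pairwise_cat => /and3P[lt1 _].
  rewrite pairwise_cons => /andP[lt2 _].
  have lt_s l : l \in s -> (l < j)%N.
    by move=> ls; apply: (allrelP lt1) => //; rewrite inE eqxx.
  apply: gs_stepP => // l jl; apply/negP => /lt_s.
  by rewrite ltnNge ltnW.
split; first by rewrite QQ; apply/matrixP=> i j; rewrite !mxE mem_enum.
pose t l := s2val (cid2 (QA l (mem_enum 'I_r l))).
exists (\matrix_(i, l) t l i 0).
split=> [i j ji|]; first by rewrite mxE /t; case: cid2 => /= v _ ->.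
apply/matrixP=> i l; have : col l A = gram_schmidt A *m t l.
  by rewrite /t; case: cid2.
move=> /matrixP/(_ i 0); rewrite !mxE => ->.
by apply: eq_bigr => m _; rewrite mxE.
Qed.

End GramSchmidt.

(** * Thresholding through an SVD *)

Section HardThreshold.
Context {R : realType}.

(** The length is kept because a program fixes the number of output columns in advance. *)
Definition threshold k (lam : R) (s : 'rV[R]_k) : 'rV[R]_k :=
  \row_j if lam <= s 0 j then s 0 j else 0.

Lemma svd_hard_threshold p q k lam (A : 'M[R]_(p, q)) (U : 'M[R]_(p, k)) s V :
  is_svd A U s V ->
  is_hard_threshold lam A (U *m diag_mx (threshold lam s) *m V^T).
Proof.
move=> svdA; exists k, U, s, V; split=> //.
apply/matrixP=> i j; rewrite mxE summxE [RHS]big_mkcond /=.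
apply: eq_bigr => l _.
rewrite mul_mx_diag !mxE; case: ifP => _; last by rewrite mulr0 mul0r.
by rewrite big_ord1 !mxE mulrCA mulrA.
Qed.

Lemma is_svd_qr n r k (A : 'M[R]_(r, n)) (W : 'M[R]_(n, r))
    (U V : 'M[R]_(r, k)) s :
  is_qf A^T W -> is_svd (W^T *m A^T)^T U s V -> is_svd A U s (W *m V).
Proof.
case=> WW [T [_ AT]] [UU VV s0 E]; split=> //.
  by rewrite trmx_mul mulmxA -[_ *m W^T *m W]mulmxA WW mulmx1.
rewrite trmx_mul mulmxA -E -[LHS]trmxK AT [in W^T *m _]mulmxA WW mul1mx.
by rewrite trmx_mul.
Qed.

End HardThreshold.

(** * Straight-line programs: cost and partial correctness *)

(* A builder receives the number of registers already in use and returns the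
   code to append together with a result that may mention register positions. *)
Section Builders.
Context {I W : Type}.

Definition builder (T : Type) := nat -> program I W * T.

(** The [Svd] case mirrors the sizes of the three [entries] lists that are appended, with the
    singular values as a 1 x k matrix. *)
Definition width (c : instr I W) : nat :=
  if c is Svd k _ then (k * k + (1 * k + k * k))%N else 1%N.

Definition widths (p : program I W) : nat := (\sum_(c <- p) width c)%N.

Definition ret T (x : T) : builder T := fun _ => ([::], x).

Definition bind T T' (b : builder T) (f : T -> builder T') : builder T' :=
  fun pos => let x := b pos in let y := f x.2 (pos + widths x.1)%N in
             (x.1 ++ y.1, y.2).

Definition emit (c : instr I W) : builder nat := fun pos => ([:: c], pos).

Definition svd_regs k (a : 'I_k -> 'I_k -> nat) :
    builder (('I_k -> 'I_k -> nat) * ('I_1 -> 'I_k -> nat) *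
             ('I_k -> 'I_k -> nat)) :=
  fun pos => ([:: Svd k a],
    (fun i j => (pos + mxvec_index i j)%N,
     fun i j => (pos + (k * k + mxvec_index i j))%N,
     fun i j => (pos + (k * k + (1 * k + mxvec_index i j)))%N)).

(** The resulting lookup function lives outside the program, so transposing, extracting a column or
    sharing a register costs no instruction. *)
Fixpoint tab_seq (T : eqType) (s : seq T) (f : T -> builder nat) :
    builder (T -> nat) :=
  if s is t :: s' then
    bind (f t) (fun a => bind (tab_seq s' f)
      (fun g => ret (fun u => if u == t then a else g u)))
  else ret (fun=> 0%N).

Definition tab (T : finType) (f : T -> builder nat) : builder (T -> nat) :=
  tab_seq (enum T) f.

Definition tabmx p q (f : 'I_p -> 'I_q -> builder nat) :
    builder ('I_p -> 'I_q -> nat) :=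
  bind (tab (fun ij => f ij.1 ij.2)) (fun g => ret (fun i j => g (i, j))).

Fixpoint sum_regs T (s : seq T) (f : T -> builder nat) : builder nat :=
  if s is t :: s' then
    bind (f t) (fun a => bind (sum_regs s' f) (fun b => emit (Add a b)))
  else emit (Const 0).

Fixpoint iter_regs T (N : nat) (f : T -> builder T) (x : T) : builder T :=
  if N is N'.+1 then bind (iter_regs N' f x) f else ret x.

Definition mulmx_regs p q r (a : 'I_p -> 'I_q -> nat) (b : 'I_q -> 'I_r -> nat)
    : builder ('I_p -> 'I_r -> nat) :=
  tabmx (fun i j => sum_regs (enum 'I_q) (fun l => emit (Mul (a i l) (b l j)))).

Definition costs T (b : builder T) (c : nat) : Prop :=
  forall pos, (cost (b pos).1 <= c)%N.

Lemma cost_cat (p p' : program I W) : cost (p ++ p') = (cost p + cost p')%N.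
Proof. by rewrite /cost big_cat. Qed.

Lemma costs_le T (b : builder T) c c' : costs b c -> (c <= c')%N -> costs b c'.
Proof. by move=> hb le_c pos; apply: leq_trans le_c. Qed.

Lemma costs_ret T (x : T) : costs (ret x) 0.
Proof. by move=> pos; rewrite /cost /= big_nil. Qed.

Lemma costs_bind T T' (b : builder T) (f : T -> builder T') c c' :
  costs b c -> (forall x, costs (f x) c') -> costs (bind b f) (c + c').
Proof.
move=> hb hf pos; rewrite /= cost_cat.
by apply: leq_add; [apply: hb | apply: hf].
Qed.

Lemma costs_emit (c : instr I W) : costs (emit c) (instr_cost c).
Proof. by move=> pos; rewrite /cost /= big_seq1. Qed.

Lemma costs_svd k (a : 'I_k -> 'I_k -> nat) : costs (svd_regs a) (k ^ 3).
Proof. by move=> pos; rewrite /cost /= big_seq1. Qed.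

(** The bound varies with the entry because sparse rows have different lengths; a uniform bound
    would charge all m nonzeros to each row. *)
Lemma costs_tab_seq (T : eqType) (s : seq T) f (c : T -> nat) :
  (forall t, costs (f t) (c t)) -> costs (tab_seq s f) (\sum_(t <- s) c t).
Proof.
move=> hf; elim: s => [|t s IHs]; first by rewrite big_nil; apply: costs_ret.
rewrite big_cons; apply: costs_bind => // a; rewrite -[X in costs _ X]addn0.
by apply: costs_bind => // g; apply: costs_ret.
Qed.

Lemma costs_tab (T : finType) (f : T -> builder nat) c :
  (forall t, costs (f t) (c t)) -> costs (tab f) (\sum_t c t).
Proof. by move=> hf; rewrite -big_enum; apply: costs_tab_seq. Qed.

Lemma costs_tabmx p q (f : 'I_p -> 'I_q -> builder nat) c :
  (forall i j, costs (f i j) (c i j)) -> costs (tabmx f) (\sum_i \sum_j c i j).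
Proof.
move=> hf; rewrite pair_big_dep -[X in costs _ X]addn0.
by apply: costs_bind => [|g]; [apply: costs_tab | apply: costs_ret].
Qed.

Lemma costs_tabmx_const p q (f : 'I_p -> 'I_q -> builder nat) c :
  (forall i j, costs (f i j) c) -> costs (tabmx f) (p * q * c).
Proof.
move=> hf; apply: costs_le (costs_tabmx hf) _.
by rewrite !(sum_nat_const, card_ord) mulnA.
Qed.

Lemma costs_sum_regs T (s : seq T) f c :
  (forall t, costs (f t) c) -> costs (sum_regs s f) (size s * c.+1).
Proof.
move=> hf; elim: s => [|t s IHs]; first exact: costs_emit.
suff : costs (sum_regs (t :: s) f) (c + (size s * c.+1 + 1)).
  by move/costs_le; apply; rewrite mulSn addn1 addnS.
apply: costs_bind => // a; apply: costs_bind => // b; exact: costs_emit.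
Qed.

Lemma costs_free (c : instr I W) : instr_cost c = 0%N -> costs (emit c) 0.
Proof. by move=> <-; apply: costs_emit. Qed.

Lemma costs_op (c : instr I W) : instr_cost c = 1%N -> costs (emit c) 1.
Proof. by move=> <-; apply: costs_emit. Qed.

Lemma costs_iter T N (f : T -> builder T) x c :
  (forall y, costs (f y) c) -> costs (iter_regs N f x) (N * c).
Proof.
move=> hf; elim: N => [|N IHN] /=; first exact: costs_ret.
by rewrite mulSn addnC; apply: costs_bind.
Qed.

Lemma costs_sum_enum p (f : 'I_p -> builder nat) c :
  (forall t, costs (f t) c) -> costs (sum_regs (enum 'I_p) f) (p * c.+1).
Proof. by rewrite -[X in (X * _)%N]size_enum_ord; apply: costs_sum_regs. Qed.

Lemma costs_mulmx p q r (a : 'I_p -> 'I_q -> nat) (b : 'I_q -> 'I_r -> nat) :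
  costs (mulmx_regs a b) (p * r * (q * 2)).
Proof.
apply: costs_tabmx_const => i j; rewrite -[X in (X * 2)%N]size_enum_ord.
by apply: (@costs_sum_regs _ _ _ 1) => l; apply: costs_emit.
Qed.

End Builders.

(** * Execution of programs and rules for partial correctness *)

Section Execution.
Context {R : realType} {I W : Type}.
Context {svd : svd_fun (R := R)} {input : I -> R} {sample : W -> R}.

Definition exec (rs : seq R) (p : program I W) : seq R :=
  foldl (step svd input sample) rs p.

Lemma exec_cat rs p p' : exec rs (p ++ p') = exec (exec rs p) p'.
Proof. exact: foldl_cat. Qed.

Lemma size_entries p q (A : 'M[R]_(p, q)) : size (entries A) = (p * q)%N.
Proof. by rewrite size_map size_enum_ord. Qed.

Lemma nth_entries p q (A : 'M[R]_(p, q)) i j :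
  (entries A)`_(mxvec_index i j) = A i j.
Proof.
have l := mxvec_index i j.
by rewrite (nth_map l) ?size_enum_ord ?ltn_ord // nth_ord_enum mxvecE.
Qed.

Lemma size_step rs c :
  size (step svd input sample rs c) = (size rs + width c)%N.
Proof.
rewrite size_cat; congr addn; case: c => //= k a.
by case: (svd _) => [[U s] V]; rewrite !size_cat !size_entries.
Qed.

Lemma size_exec rs p : size (exec rs p) = (size rs + widths p)%N.
Proof.
rewrite /widths; elim: p rs => [|c p IHp] rs /=; first by rewrite big_nil addn0.
by rewrite IHp size_step big_cons addnA.
Qed.

Lemma prefix_exec rs p : prefix rs (exec rs p).
Proof.
elim: p rs => [|c p IHp] rs /=; first exact: prefix_refl.
by apply: prefix_trans (IHp _); apply: prefix_prefix.
Qed.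

(** Beyond the end of the list [nth] returns 0, a value that later instructions can change; the
    range condition makes the assertion stable under extension. *)
Definition holds (rs : seq R) (a : nat) (x : R) : Prop :=
  (a < size rs)%N /\ rs`_a = x.

Definition mxholds p q (rs : seq R) (a : 'I_p -> 'I_q -> nat) (A : 'M[R]_(p, q))
  : Prop := forall i j, holds rs (a i j) (A i j).

Lemma holds_prefix rs rs' a x : prefix rs rs' -> holds rs a x -> holds rs' a x.
Proof.
move=> /prefixP[t ->] [lt_a <-]; split; last by rewrite nth_cat lt_a.
by rewrite size_cat ltn_addr.
Qed.

Lemma mxholds_prefix p q rs rs' a (A : 'M[R]_(p, q)) :
  prefix rs rs' -> mxholds rs a A -> mxholds rs' a A.
Proof. by move=> le_rs ha i j; apply: holds_prefix (ha i j). Qed.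

(* Quantifying over the extensions of rs lets b be preceded by more code. *)
Definition yields T (rs : seq R) (b : builder T) (Q : seq R -> T -> Prop) :=
  forall rs', prefix rs rs' ->
    Q (exec rs' (b (size rs')).1) (b (size rs')).2.

Lemma yields_prefix T rs rs' (b : @builder I W T) Q :
  prefix rs rs' -> yields rs b Q -> yields rs' b Q.
Proof. by move=> le_rs hb rs2 le2; apply: hb; apply: prefix_trans le2. Qed.

Lemma yields_ret T rs (x : T) (Q : seq R -> T -> Prop) :
  (forall rs', prefix rs rs' -> Q rs' x) -> yields rs (ret x) Q.
Proof. by []. Qed.

Lemma yields_bind T T' rs (b : builder T) (f : T -> builder T') Q Q' :
  yields rs b Q ->
  (forall rs' x, prefix rs rs' -> Q rs' x -> yields rs' (f x) Q') ->
  yields rs (bind b f) Q'.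
Proof.
move=> hb hf rs' le_rs; rewrite /bind /= exec_cat.
have le' : prefix rs (exec rs' (b (size rs')).1).
  exact: prefix_trans le_rs (prefix_exec _ _).
(* [size_exec] identifies the position that [bind] computes from [widths] with the actual number of
   registers. *)
by have := hf _ _ le' (hb _ le_rs) _ (prefix_refl _); rewrite size_exec.
Qed.

Lemma yields_emit rs c x :
  (forall rs', prefix rs rs' -> step svd input sample rs' c = rs' ++ [:: x]) ->
  yields rs (emit c) (fun rs' a => holds rs' a x).
Proof.
move=> hc rs' le_rs; rewrite /exec /= hc //; split.
  by rewrite size_cat addn1.
by rewrite nth_cat ltnn subnn.
Qed.

Lemma yields_input rs i :
  yields rs (emit (Input i)) (fun rs' a => holds rs' a (input i)).
Proof. exact: yields_emit. Qed.

Lemma yields_draw rs w :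
  yields rs (emit (Draw w)) (fun rs' a => holds rs' a (sample w)).
Proof. exact: yields_emit. Qed.

Lemma yields_const rs a :
  yields rs (emit (Const a)) (fun rs' b => holds rs' b (ratr a)).
Proof. exact: yields_emit. Qed.

Lemma yields_add rs a b x y : holds rs a x -> holds rs b y ->
  yields rs (emit (Add a b)) (fun rs' c => holds rs' c (x + y)).
Proof.
move=> ha hb; apply: yields_emit => rs' le_rs.
by rewrite /step (holds_prefix le_rs ha).2 (holds_prefix le_rs hb).2.
Qed.

Lemma yields_sub rs a b x y : holds rs a x -> holds rs b y ->
  yields rs (emit (Defs.Sub a b)) (fun rs' c => holds rs' c (x - y)).
Proof.
move=> ha hb; apply: yields_emit => rs' le_rs.
by rewrite /step (holds_prefix le_rs ha).2 (holds_prefix le_rs hb).2.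
Qed.

Lemma yields_mul rs a b x y : holds rs a x -> holds rs b y ->
  yields rs (emit (Mul a b)) (fun rs' c => holds rs' c (x * y)).
Proof.
move=> ha hb; apply: yields_emit => rs' le_rs.
by rewrite /step (holds_prefix le_rs ha).2 (holds_prefix le_rs hb).2.
Qed.

Lemma yields_div rs a b x y : holds rs a x -> holds rs b y ->
  yields rs (emit (Div a b)) (fun rs' c => holds rs' c (x / y)).
Proof.
move=> ha hb; apply: yields_emit => rs' le_rs.
by rewrite /step (holds_prefix le_rs ha).2 (holds_prefix le_rs hb).2.
Qed.

Lemma yields_sqrt rs a x : holds rs a x ->
  yields rs (emit (Sqrt a)) (fun rs' c => holds rs' c (Num.sqrt x)).
Proof.
move=> ha; apply: yields_emit => rs' le_rs.
by rewrite /step (holds_prefix le_rs ha).2.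
Qed.

Lemma yields_select rs a b c d x y z t :
  holds rs a x -> holds rs b y -> holds rs c z -> holds rs d t ->
  yields rs (emit (Select a b c d))
    (fun rs' e => holds rs' e (if x <= y then z else t)).
Proof.
move=> ha hb hc hd; apply: yields_emit => rs' le_rs.
rewrite /step (holds_prefix le_rs ha).2 (holds_prefix le_rs hb).2.
by rewrite (holds_prefix le_rs hc).2 (holds_prefix le_rs hd).2.
Qed.

Lemma yields_svd rs k (a : 'I_k -> 'I_k -> nat) A : mxholds rs a A ->
  yields rs (svd_regs a) (fun rs' x =>
    [/\ mxholds rs' x.1.1 (svd A).1.1, mxholds rs' x.1.2 (svd A).1.2
      & mxholds rs' x.2 (svd A).2]).
Proof.
move=> ha rs' le_rs; rewrite /exec /= /step.
have -> : \matrix_(i, j) rs'`_(a i j) = A.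
  by apply/matrixP=> i j; rewrite mxE (holds_prefix le_rs (ha i j)).2.
case: (svd A) => [[U s] V] /=.
have lt_index p q (i : 'I_p) (j : 'I_q) : (mxvec_index i j < p * q)%N.
  exact: ltn_ord.
split=> i j; (split;
  [by rewrite !size_cat !size_entries !(ltn_add2l, lt_index, ltn_addr)|]).
- by rewrite nth_cat ltnNge leq_addr /= addKn nth_cat size_entries lt_index
    nth_entries.
- rewrite nth_cat ltnNge leq_addr /= addKn nth_cat size_entries ltnNge leq_addr.
  by rewrite /= addKn nth_cat size_entries lt_index nth_entries.
rewrite nth_cat ltnNge leq_addr /= addKn nth_cat size_entries ltnNge leq_addr.
rewrite /= addKn nth_cat size_entries ltnNge leq_addr /= addKn.
by rewrite nth_entries.
Qed.

Lemma yields_tab_seq (T : eqType) (s : seq T) rs f (x : T -> R) :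
  (forall t, yields rs (f t) (fun rs' a => holds rs' a (x t))) ->
  yields rs (tab_seq s f)
    (fun rs' g => forall t, t \in s -> holds rs' (g t) (x t)).
Proof.
elim: s rs => [|t s IHs] rs hf //=.
apply: (yields_bind (hf t)) => rs1 a le1 ha.
apply: yields_bind (IHs rs1 _) _ => [u|rs2 g le2 hg].
  exact: yields_prefix (hf u).
apply: yields_ret => rs3 le3 u; rewrite inE; case: eqVneq => [-> _|_ /= u_s].
  exact: holds_prefix (prefix_trans le2 le3) ha.
exact: holds_prefix le3 (hg u u_s).
Qed.

Lemma yields_tab (T : finType) rs f (x : T -> R) :
  (forall t, yields rs (f t) (fun rs' a => holds rs' a (x t))) ->
  yields rs (tab f) (fun rs' g => forall t, holds rs' (g t) (x t)).
Proof.
move=> hf rs' le_rs t.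
by apply: (yields_tab_seq (s := enum T) hf le_rs); rewrite mem_enum.
Qed.

Lemma yields_tabmx p q rs f (A : 'M[R]_(p, q)) :
  (forall i j, yields rs (f i j) (fun rs' a => holds rs' a (A i j))) ->
  yields rs (tabmx f) (fun rs' a => mxholds rs' a A).
Proof.
move=> hf; apply: yields_bind (yields_tab (fun ij => hf ij.1 ij.2)) _.
move=> rs1 g le1 hg; apply: yields_ret => rs2 le2 i j.
exact: holds_prefix le2 (hg (i, j)).
Qed.

Lemma yields_sum T (s : seq T) rs f (x : T -> R) :
  (forall t, yields rs (f t) (fun rs' a => holds rs' a (x t))) ->
  yields rs (sum_regs s f) (fun rs' a => holds rs' a (\sum_(t <- s) x t)).
Proof.
elim: s rs => [|t s IHs] rs hf.
  by rewrite big_nil; have := yields_const (rs := rs) 0; rewrite rmorph0.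
rewrite big_cons; apply: (yields_bind (hf t)) => rs1 a le1 ha.
apply: yields_bind (IHs rs1 _) _ => [u|rs2 b le2 hb].
  exact: yields_prefix (hf u).
exact: yields_add (holds_prefix le2 ha) hb.
Qed.

Lemma yields_mulmx p q r rs a b (A : 'M[R]_(p, q)) (B : 'M[R]_(q, r)) :
  mxholds rs a A -> mxholds rs b B ->
  yields rs (mulmx_regs a b) (fun rs' c => mxholds rs' c (A *m B)).
Proof.
move=> ha hb; apply: yields_tabmx => i j; rewrite mxE -big_enum.
by apply: yields_sum => l; apply: yields_mul.
Qed.

End Execution.

Arguments exec {R I W} svd input sample rs p.
Arguments yields {R I W} svd input sample {T} rs b Q.

(** Run on an unknown bound, this assembles the bound from the code and leaves the called
    subroutines as goals; comparing it with the stated bound is then arithmetic. *)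
Ltac count := repeat lazymatch goal with
  | |- costs (mulmx_regs _ _) _ => apply: costs_mulmx
  | |- costs (emit (Const _)) _ => by apply: costs_free
  | |- costs (emit (Input _)) _ => by apply: costs_free
  | |- costs (emit _) _ => by apply: costs_op
  | |- costs (ret _) _ => apply: costs_ret
  | |- costs (bind _ _) _ => eapply costs_bind; [| intro]
  | |- costs (sum_regs (enum _) _) _ => eapply costs_sum_enum; intro
  | |- costs (tabmx _) _ => eapply costs_tabmx_const; do 2 intro
  end.

(** * The algorithms as code, and their operation counts *)

Section Algorithms.
Context {I W : Type}.
Implicit Types (n r k m : nat).

(** The filter is evaluated while the code is generated, so only stored entries produce
    instructions. *)
Definition sparse_mulmx_regs n r m (d : 'I_1 -> 'I_m -> nat)
    (dst src : 'I_m -> 'I_n) (q : 'I_n -> 'I_r -> nat) :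
    @builder I W ('I_n -> 'I_r -> nat) :=
  tabmx (fun i j => sum_regs [seq e <- enum 'I_m | dst e == i]
                      (fun e => emit (Mul (d 0 e) (q (src e) j)))).

(** Associated as U (S (V^T Q)), so no dense n x n matrix is formed. Exchanging [u] with [v] and
    [dst] with [src] applies the transpose. *)
Definition apply_regs n r k m (u v : 'I_n -> 'I_k -> nat)
    (s : 'I_1 -> 'I_k -> nat) (d : 'I_1 -> 'I_m -> nat) (dst src : 'I_m -> 'I_n)
    (q : 'I_n -> 'I_r -> nat) : @builder I W ('I_n -> 'I_r -> nat) :=
  bind (mulmx_regs (fun l i => v i l) q) (fun vq =>
  bind (tabmx (fun l j => emit (Mul (s 0 l) (vq l j)))) (fun svq =>
  bind (mulmx_regs u svq) (fun usvq =>
  bind (sparse_mulmx_regs d dst src q) (fun dq =>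
  tabmx (fun i j => emit (Add (usvq i j) (dq i j))))))).

Definition oproj_regs n r (q : 'I_n -> 'I_r -> nat) (x : 'I_n -> 'I_1 -> nat) :
    @builder I W ('I_n -> 'I_1 -> nat) :=
  bind (mulmx_regs (fun l i => q i l) x) (fun t =>
  bind (mulmx_regs q t) (fun y =>
  tabmx (fun i j => emit (Defs.Sub (x i j) (y i j))))).

Definition sqnorm_regs n (x : 'I_n -> 'I_1 -> nat) : @builder I W nat :=
  sum_regs (enum 'I_n) (fun i => emit (Mul (x i 0) (x i 0))).

Definition leftover_regs n r (one : nat) (q : 'I_n -> 'I_r -> nat) :
    @builder I W ('I_n -> 'I_1 -> nat) :=
  tabmx (fun i _ =>
    bind (sum_regs (enum 'I_r) (fun l => emit (Mul (q i l) (q i l))))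
         (fun t => emit (Defs.Sub one t))).

Fixpoint first_pos_regs n (zero one : nat) (c : 'I_n -> 'I_1 -> nat)
    (s : seq 'I_n) (found : nat) : @builder I W ('I_n -> 'I_1 -> nat) :=
  if s is i0 :: s' then
    bind (emit (Select (c i0 0) found zero one)) (fun b =>
    bind (emit (Add found b)) (fun found' =>
    bind (first_pos_regs zero one c s' found') (fun g =>
    ret (fun i j => if i == i0 then b else g i j))))
  else ret (fun _ _ => zero).

(** The fallback vector is always computed, and one [Select] per row then chooses between it and the
    given column. *)
Definition gs_step_regs n r (a q : 'I_n -> 'I_r -> nat) (j : 'I_r) :
    @builder I W ('I_n -> 'I_r -> nat) :=
  bind (emit (Const 0)) (fun zero =>
  bind (emit (Const 1)) (fun one =>
  bind (oproj_regs q (fun i _ => a i j)) (fun w =>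
  bind (sqnorm_regs w) (fun w2 =>
  bind (leftover_regs one q) (fun c =>
  bind (first_pos_regs zero one c (enum 'I_n) zero) (fun f =>
  bind (tabmx (fun i l => emit (Select w2 zero (f i l) (a i j)))) (fun x =>
  bind (oproj_regs q x) (fun y =>
  bind (sqnorm_regs y) (fun y2 =>
  bind (emit (Sqrt y2)) (fun norm_y =>
  bind (tabmx (fun i l => emit (Div (y i l) norm_y))) (fun z =>
  ret (fun i l => if l == j then z i 0 else q i l)))))))))))).

Fixpoint gs_loop_regs n r (a : 'I_n -> 'I_r -> nat) (js : seq 'I_r)
    (q : 'I_n -> 'I_r -> nat) : @builder I W ('I_n -> 'I_r -> nat) :=
  if js is j :: js' then bind (gs_step_regs a q j) (gs_loop_regs a js')
  else ret q.

Definition gram_schmidt_regs n r (a : 'I_n -> 'I_r -> nat) :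
    @builder I W ('I_n -> 'I_r -> nat) :=
  bind (emit (Const 0)) (fun zero =>
  gs_loop_regs a (enum 'I_r) (fun _ _ => zero)).

Definition power_step_regs n r k m (u v : 'I_n -> 'I_k -> nat)
    (s : 'I_1 -> 'I_k -> nat) (d : 'I_1 -> 'I_m -> nat)
    (row_of col_of : 'I_m -> 'I_n) (c : nat) (q : 'I_n -> 'I_r -> nat) :
    @builder I W ('I_n -> 'I_r -> nat) :=
  bind (apply_regs v u s d col_of row_of q) (fun yq =>
  bind (apply_regs u v s d row_of col_of yq) (fun yyq =>
  bind (tabmx (fun i j => bind (emit (Mul c (q i j))) (fun t =>
                          emit (Add (yyq i j) t))))
       (@gram_schmidt_regs n r))).

Definition range_finder_regs n r k m (u v : 'I_n -> 'I_k -> nat)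
    (s : 'I_1 -> 'I_k -> nat) (d : 'I_1 -> 'I_m -> nat)
    (row_of col_of : 'I_m -> 'I_n) (tau : nat) (g : 'I_n -> 'I_r -> nat)
    (N : nat) : @builder I W ('I_n -> 'I_r -> nat) :=
  bind (emit (Mul tau tau)) (fun tau2 =>
  bind (emit (Const 4096)) (fun c =>
  bind (emit (Div tau2 c)) (fun shift =>
  bind (gram_schmidt_regs g)
       (iter_regs N (power_step_regs u v s d row_of col_of shift))))).

Definition hard_threshold_regs n r k m (u v : 'I_n -> 'I_k -> nat)
    (s : 'I_1 -> 'I_k -> nat) (d : 'I_1 -> 'I_m -> nat)
    (row_of col_of : 'I_m -> 'I_n) (tau : nat) (q : 'I_n -> 'I_r -> nat) :
    @builder I W (('I_n -> 'I_r -> nat) * ('I_1 -> 'I_r -> nat) *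
                  ('I_n -> 'I_r -> nat)) :=
  bind (apply_regs v u s d col_of row_of q) (fun b =>
  bind (gram_schmidt_regs b) (fun w =>
  bind (mulmx_regs (fun l i => w i l) b) (fun t =>
  bind (svd_regs (fun i j => t j i)) (fun x =>
  bind (mulmx_regs q x.1.1) (fun qu =>
  bind (mulmx_regs w x.2) (fun wv =>
  bind (emit (Const 0)) (fun zero =>
  bind (emit (Const 8)) (fun eight =>
  bind (emit (Div tau eight)) (fun lam =>
  bind (tabmx (fun i l => emit (Select lam (x.1.2 i l) (x.1.2 i l) zero)))
       (fun s' => ret (qu, s', wv))))))))))).

Definition misfit_regs n k m (u v : 'I_n -> 'I_k -> nat)
    (s x : 'I_1 -> _ -> nat) (row_of col_of : 'I_m -> 'I_n) :
    @builder I W ('I_1 -> 'I_m -> nat) :=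
  tabmx (fun i e =>
    bind (sum_regs (enum 'I_k) (fun l =>
            bind (emit (Mul (u (row_of e) l) (s 0 l))) (fun t =>
            emit (Mul t (v (col_of e) l)))))
         (fun z => emit (Defs.Sub (x i e) z))).

(** The allowed cost is a multiple of m r, which is 0 for m = 0, so the two square roots and the
    division must then be avoided; the residual is 0 anyway. *)
Definition residual_regs m (e : 'I_1 -> 'I_m -> nat) (q : nat) :
    @builder I W nat :=
  if m == 0%N then emit (Const 0) else
  bind (sum_regs (enum 'I_m) (fun l => emit (Mul (e 0 l) (e 0 l)))) (fun t =>
  bind (emit (Sqrt t)) (fun a =>
  bind (emit (Sqrt q)) (fun b => emit (Div a b)))).

Lemma costs_sparse_mulmx n r m (d : 'I_1 -> 'I_m -> nat) dst src
    (q : 'I_n -> 'I_r -> nat) :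
  costs (sparse_mulmx_regs d dst src q) (m * r * 2).
Proof.
eapply costs_le.
  eapply costs_tabmx => i j; apply: (@costs_sum_regs _ _ _ _ _ 1) => e.
  exact: costs_op.
rewrite exchange_big sum_nat_const card_ord -big_distrl /= mulnCA mulnA.
(* The fibres of [dst] partition the m stored entries. *)
suff -> : (\sum_i size [seq e <- enum 'I_m | dst e == i] = m)%N by [].
rewrite -[RHS]card_ord -sum1_card (partition_big dst predT) //=.
by apply: eq_bigr => i _; rewrite size_filter -sum1_count enumT.
Qed.

(** The two dense products take 4 n k r operations, the scaling k r, the sparse product 2 m r and
    the final sum n r. *)
Lemma costs_apply n r k m (u v : 'I_n -> 'I_k -> nat) s
    (d : 'I_1 -> 'I_m -> nat) dst src (q : 'I_n -> 'I_r -> nat) :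
  (k <= r)%N -> (r <= n)%N ->
  costs (apply_regs u v s d dst src q) (6 * (m * r + n * r ^ 2)).
Proof.
move=> le_kr le_rn; rewrite /apply_regs; eapply costs_le.
  by count; apply: costs_sparse_mulmx.
nia.
Qed.

Lemma costs_oproj n r (q : 'I_n -> 'I_r -> nat) x :
  costs (oproj_regs q x) (n * (4 * r + 1)).
Proof. rewrite /oproj_regs; by eapply costs_le; [count | nia]. Qed.

Lemma costs_sqnorm n (x : 'I_n -> 'I_1 -> nat) :
  costs (sqnorm_regs x) (n * 2).
Proof. by rewrite /sqnorm_regs; count. Qed.

Lemma costs_leftover n r one (q : 'I_n -> 'I_r -> nat) :
  costs (leftover_regs one q) (n * (2 * r + 1)).
Proof. rewrite /leftover_regs; by eapply costs_le; [count | nia]. Qed.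

Lemma costs_first_pos n zero one c (s : seq 'I_n) found :
  costs (first_pos_regs zero one c s found) (size s * 2).
Proof.
elim: s found => [|i0 s IHs] found /=; first exact: costs_ret.
by eapply costs_le; [count; apply: IHs | lia].
Qed.

Lemma costs_gs_step n r (a q : 'I_n -> 'I_r -> nat) j :
  (0 < r)%N -> (0 < n)%N ->
  costs (gs_step_regs a q j) (23 * (n * r)).
Proof.
move=> r_gt0 n_gt0; rewrite /gs_step_regs; eapply costs_le.
  count; [exact: costs_oproj | exact: costs_sqnorm | exact: costs_leftover
    | exact: costs_first_pos | exact: costs_oproj | exact: costs_sqnorm].
(* The total 10 n r + 11 n + 1 is absorbed into n r using n, r >= 1. *)
rewrite size_enum_ord; nia.
Qed.

Lemma costs_gram_schmidt n r (a : 'I_n -> 'I_r -> nat) :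
  (0 < r)%N -> (0 < n)%N ->
  costs (gram_schmidt_regs a) (23 * (n * r ^ 2)).
Proof.
move=> r_gt0 n_gt0.
suff loop js q : costs (gs_loop_regs a js q) (size js * (23 * (n * r))).
  rewrite /gram_schmidt_regs; eapply costs_le; first by count; apply: loop.
  by rewrite size_enum_ord; nia.
elim: js q => [|j js IHjs] q; first exact: costs_ret.
by rewrite mulSn; apply: costs_bind; first exact: costs_gs_step.
Qed.

Lemma costs_power_step n r k m (u v : 'I_n -> 'I_k -> nat) s
    (d : 'I_1 -> 'I_m -> nat) row_of col_of c (q : 'I_n -> 'I_r -> nat) :
  (0 < r)%N -> (k <= r)%N -> (r <= n)%N ->
  costs (power_step_regs u v s d row_of col_of c q)
        (37 * (m * r + n * r ^ 2)).
Proof.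
move=> r_gt0 le_kr le_rn; have n_gt0 := leq_trans r_gt0 le_rn.
rewrite /power_step_regs; eapply costs_le.
  by count; [apply: costs_apply | apply: costs_apply
    | apply: costs_gram_schmidt].
(* 37 = 6 + 6 + 2 + 23: two applications, the shift, and Gram-Schmidt. *)
nia.
Qed.

Lemma costs_range_finder n r k m (u v : 'I_n -> 'I_k -> nat) s
    (d : 'I_1 -> 'I_m -> nat) row_of col_of tau (g : 'I_n -> 'I_r -> nat) N :
  (0 < r)%N -> (k <= r)%N -> (r <= n)%N ->
  costs (range_finder_regs u v s d row_of col_of tau g N)
        (37 * (N.+1 * (m * r + n * r ^ 2))).
Proof.
move=> r_gt0 le_kr le_rn; have n_gt0 := leq_trans r_gt0 le_rn.
rewrite /range_finder_regs; eapply costs_le.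
  by count; [apply: costs_gram_schmidt
    | apply: costs_iter => q; apply: costs_power_step].
(* The extra unit in [N.+1] pays for the initial QR and, by this positivity, for the two scalar
   operations forming the shift. *)
have : (0 < n * r ^ 2)%N by rewrite muln_gt0 n_gt0 expn_gt0 r_gt0.
nia.
Qed.

Lemma costs_hard_threshold n r k m (u v : 'I_n -> 'I_k -> nat) s
    (d : 'I_1 -> 'I_m -> nat) row_of col_of tau (q : 'I_n -> 'I_r -> nat) :
  (0 < r)%N -> (k <= r)%N -> (r <= n)%N ->
  costs (hard_threshold_regs u v s d row_of col_of tau q)
        (40 * (m * r + n * r ^ 2)).
Proof.
move=> r_gt0 le_kr le_rn; have n_gt0 := leq_trans r_gt0 le_rn.
rewrite /hard_threshold_regs; eapply costs_le.
  by count; [apply: costs_apply | apply: costs_gram_schmidt | apply: costs_svd].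
have : (0 < n * r ^ 2)%N by rewrite muln_gt0 n_gt0 expn_gt0 r_gt0.
have : (r ^ 3 <= n * r ^ 2)%N by rewrite expnS leq_mul2r le_rn orbT.
have : (r <= n * r ^ 2)%N by rewrite mulnCA leq_pmulr // muln_gt0 n_gt0.
nia.
Qed.

Lemma costs_misfit n k m (u v : 'I_n -> 'I_k -> nat) s x
    (row_of col_of : 'I_m -> 'I_n) :
  costs (misfit_regs u v s x row_of col_of) (m * (3 * k + 1)).
Proof. rewrite /misfit_regs; by eapply costs_le; [count | nia]. Qed.

Lemma costs_residual m (e : 'I_1 -> 'I_m -> nat) q :
  costs (residual_regs e q) (5 * m).
Proof.
rewrite /residual_regs; case: eqVneq => [->|m_gt0]; first by apply: costs_free.
by eapply costs_le; [count | lia].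
Qed.

End Algorithms.

(** * Correctness of the algorithms *)

Section LowRankPlusSparse.
Context {R : realType} {n k m : nat}.
Implicit Types (U V : 'M[R]_(n, k)) (s : 'rV[R]_k) (D : 'rV[R]_m).

(** Coordinate format, where repeated positions add up. Transposing exchanges the two index maps. *)
Definition sparse_mx D (dst src : 'I_m -> 'I_n) : 'M[R]_n :=
  \matrix_(i, j) \sum_(e | (dst e == i) && (src e == j)) D 0 e.

Definition low_rank_plus_sparse U V s D dst src : 'M[R]_n :=
  U *m diag_mx s *m V^T + sparse_mx D dst src.

Lemma tr_low_rank_plus_sparse U V s D dst src :
  (low_rank_plus_sparse U V s D dst src)^T =
  low_rank_plus_sparse V U s D src dst.
Proof.
rewrite /low_rank_plus_sparse linearD /= !trmx_mul trmxK tr_diag_mx mulmxA.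
congr (_ + _); apply/matrixP=> i j; rewrite !mxE.
by apply: eq_bigl => e; rewrite andbC.
Qed.

Lemma sparse_mulmxE r D dst src (Q : 'M[R]_(n, r)) i j :
  (sparse_mx D dst src *m Q) i j =
  \sum_(e <- [seq e <- enum 'I_m | dst e == i]) D 0 e * Q (src e) j.
Proof.
rewrite mxE big_filter big_enum_cond /= (partition_big src predT) //=.
apply: eq_bigr => l _; rewrite mxE mulr_suml.
by apply: eq_bigr => e /andP[_ /eqP->].
Qed.

End LowRankPlusSparse.

Definition observed_row {R : realType} n (Lam : {set 'I_n * 'I_n})
    (A : 'M[R]_n) : 'rV[R]_#|Lam| :=
  \row_e A (enum_val e).1 (enum_val e).2.

Lemma sum_enum_val (R : nmodType) (T : finType) (A : {set T}) (P : pred T)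
    (F : T -> R) :
  \sum_(e < #|A| | P (enum_val e)) F (enum_val e) = \sum_(p in A | P p) F p.
Proof. by rewrite big_enum_val_cond. Qed.

(** [enum_val] lists [Lam] without repetition, so at most one term of each coordinate sum
    survives. *)
Lemma sparse_observed (R : realType) n (Lam : {set 'I_n * 'I_n}) (A : 'M[R]_n) :
  sparse_mx (observed_row Lam A) (fun e => (enum_val e).1)
    (fun e => (enum_val e).2) = proj_entries Lam A.
Proof.
apply/matrixP=> i j; rewrite !mxE.
under eq_bigr do rewrite mxE.
rewrite (sum_enum_val Lam (fun p => (p.1 == i) && (p.2 == j))
  (fun p => A p.1 p.2)) /=.
rewrite (eq_bigl (fun p => (p == (i, j)) && ((i, j) \in Lam))) => [|[a b]].
  case: ifP => _; last by rewrite big1 // => p; rewrite andbF.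
  by under eq_bigl do rewrite andbT; rewrite big_pred1_eq.
by rewrite xpair_eqE andbC; case: eqVneq => //= ->; case: eqVneq => //= ->.
Qed.

Lemma frobenius_proj_entries (R : realType) n (Lam : {set 'I_n * 'I_n})
    (A : 'M[R]_n) :
  frobenius (proj_entries Lam A) =
  Num.sqrt (\sum_e observed_row Lam A 0 e ^+ 2).
Proof.
congr Num.sqrt; rewrite pair_big_dep /=.
under [RHS]eq_bigr do rewrite mxE.
rewrite (sum_enum_val Lam xpredT (fun p => A p.1 p.2 ^+ 2)) [RHS]big_mkcond /=.
apply: eq_bigr => -[i j] _; rewrite mxE /=.
by case: ifP => // _; rewrite expr0n.
Qed.

(** * The functions on matrices that the code computes *)

Section RangeFinder.
Context {R : realType} {n r : nat}.

Definition power_step (Y : 'M[R]_n) (c : R) (Q : 'M[R]_(n, r)) : 'M[R]_(n, r) :=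
  gram_schmidt (Y *m (Y^T *m Q) + c *: Q).

Definition range_finder Y tau N (G : 'M[R]_(n, r)) : 'M[R]_(n, r) :=
  iter N (power_step Y (tau ^+ 2 / 4096)) (gram_schmidt G).

Definition threshold_factors (svd : svd_fun) lam (Y : 'M[R]_n)
    (Q : 'M[R]_(n, r)) : 'M[R]_(n, r) * 'rV[R]_r * 'M[R]_(n, r) :=
  let B := Y^T *m Q in
  let W := gram_schmidt B in
  let x := svd r (W^T *m B)^T in
  (Q *m x.1.1, threshold lam x.1.2, W *m x.2).

End RangeFinder.

Lemma is_T_range_finder (R : realType) n r (tau : R) (G : 'M[R]_(n, r))
    (Y : 'M[R]_n) (svd : svd_fun) : svd_correct svd -> (r <= n)%N ->
  let Q := range_finder Y tau (@num_iter R n) G in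
  let f := threshold_factors svd (tau / 8) Y Q in
  is_T tau G Y (f.1.1 *m diag_mx f.1.2 *m f.2^T).
Proof.
move=> svdP le_rn Q; rewrite /threshold_factors.
set W := gram_schmidt _; set x := svd _ _ => /=.
(* The Gram-Schmidt iterates are the witness; [iter] unfolds by computation, so each QR condition is
   an instance of [gram_schmidtP]. *)
exists (fun t => range_finder Y tau t G); split.
- exact: gram_schmidtP.
- by move=> t _; apply: gram_schmidtP.
exists (x.1.1 *m diag_mx (threshold (tau / 8) x.1.2) *m (W *m x.2)^T).
split; last by rewrite !mulmxA.
have E : (Q^T *m Y)^T = Y^T *m Q by rewrite trmx_mul trmxK.
apply: svd_hard_threshold; apply: (is_svd_qr (A := Q^T *m Y)); rewrite E.
  exact: gram_schmidtP.
exact: svdP.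
Qed.

(* Registers are never overwritten: what holds of rs holds of its extensions. *)
Ltac advance le := repeat match type of le with is_true (prefix ?rs _) =>
  match goal with
  | h : holds rs _ _ |- _ => apply (holds_prefix le) in h
  | h : mxholds rs _ _ |- _ => apply (mxholds_prefix le) in h
  end end; clear le.

Tactic Notation "next" simple_intropattern(x) simple_intropattern(h) :=
  let rs := fresh "rs" in let le := fresh "le" in
  intros rs x le h; cbv beta in h; advance le.

(** * The code computes these functions *)

Section Correctness.
Context {R : realType} {I W : Type}.
Context {svd : svd_fun (R := R)} {input : I -> R} {sample : W -> R}.
Implicit Types (n r k m : nat) (rs : seq R).

Local Notation yields := (yields svd input sample).

Lemma yields_iter T N (f : T -> builder T) x rs
    (Q : nat -> seq R -> T -> Prop) :
  (forall N rs' y, prefix rs rs' -> Q N rs' y -> yields rs' (f y) (Q N.+1)) ->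
  yields rs (ret x) (Q 0%N) -> yields rs (iter_regs N f x) (Q N).
Proof.
move=> hf hx; elim: N => //= N IHN.
by apply: (yields_bind IHN) => rs' y; apply: hf.
Qed.

Lemma yields_sparse_mulmx n r m rs d dst src q (D : 'rV[R]_m)
    (Q : 'M[R]_(n, r)) :
  mxholds rs d D -> mxholds rs q Q ->
  yields rs (sparse_mulmx_regs d dst src q)
    (fun rs' a => mxholds rs' a (sparse_mx D dst src *m Q)).
Proof.
move=> hd hq; apply: yields_tabmx => i j; rewrite sparse_mulmxE.
by apply: yields_sum => e; apply: yields_mul.
Qed.

Lemma yields_apply n r k m rs u v s d dst src q (U V : 'M[R]_(n, k))
    (S : 'rV[R]_k) (D : 'rV[R]_m) (Q : 'M[R]_(n, r)) :
  mxholds rs u U -> mxholds rs v V -> mxholds rs s S -> mxholds rs d D ->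
  mxholds rs q Q ->
  yields rs (apply_regs u v s d dst src q)
    (fun rs' a => mxholds rs' a (low_rank_plus_sparse U V S D dst src *m Q)).
Proof.
rewrite /apply_regs.
move=> hu hv hs hd hq.
have hvT : mxholds rs (fun l i => v i l) V^T by move=> i j; rewrite mxE.
apply: yields_bind (yields_mulmx hvT hq) _; next vq hvq.
eapply yields_bind.
  apply: (yields_tabmx (A := diag_mx S *m (V^T *m Q))) => l j.
  by rewrite mul_diag_mx mxE; apply: yields_mul.
next svq hsvq; apply: yields_bind (yields_mulmx hu hsvq) _; next usvq husvq.
apply: yields_bind (yields_sparse_mulmx dst src hd hq) _; next dq hdq.
rewrite mulmxDl -!mulmxA; apply: yields_tabmx => i j.
by rewrite mxE; apply: yields_add.
Qed.

Lemma yields_oproj n r rs q x (Q : 'M[R]_(n, r)) X :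
  mxholds rs q Q -> mxholds rs x X ->
  yields rs (oproj_regs q x) (fun rs' a => mxholds rs' a (oproj Q X)).
Proof.
rewrite /oproj_regs.
move=> hq hx.
have hqT : mxholds rs (fun l i => q i l) Q^T by move=> i j; rewrite mxE.
apply: yields_bind (yields_mulmx hqT hx) _; next t ht.
apply: yields_bind (yields_mulmx hq ht) _; next y hy.
by apply: yields_tabmx => i j; rewrite !mxE; apply: yields_sub;
  [apply: hx | have := hy i j; rewrite mxE].
Qed.

Lemma yields_sqnorm n rs x (X : 'cV[R]_n) : mxholds rs x X ->
  yields rs (sqnorm_regs x) (fun rs' a => holds rs' a (sqnorm X)).
Proof.
move=> hx; rewrite /sqnorm -big_enum.
by apply: yields_sum => i; rewrite expr2; apply: yields_mul.
Qed.

Lemma yields_leftover n r rs one q (Q : 'M[R]_(n, r)) :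
  holds rs one 1 -> mxholds rs q Q ->
  yields rs (leftover_regs one q)
    (fun rs' a => mxholds rs' a (\col_i leftover Q i)).
Proof.
move=> h1 hq; apply: yields_tabmx => i j; rewrite mxE /leftover -big_enum.
apply: yields_bind.
  by apply: yields_sum => l; apply: yields_mul; apply: hq.
by next t ht; apply: yields_sub.
Qed.

Lemma yields_first_pos n rs zero one c (C : 'I_n -> R) s found x :
  holds rs zero 0 -> holds rs one 1 -> mxholds rs c (\col_i C i) ->
  holds rs found x ->
  yields rs (first_pos_regs zero one c s found)
    (fun rs' a => mxholds rs' a (\col_i first_pos C s x i)).
Proof.
elim: s rs found x => [|i0 s IHs] rs found x h0 h1 hc hx /=.
  apply: yields_ret => rs' le i j; rewrite mxE; exact: holds_prefix le h0.
have := hc i0 0; rewrite mxE => hc0.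
apply: yields_bind (yields_select hc0 hx h0 h1) _; next b hb.
apply: yields_bind (yields_add hx hb) _; next f hf.
apply: yields_bind (IHs _ _ _ h0 h1 hc hf) _; next g hg.
apply: yields_ret => rs' le; advance le => i j; rewrite mxE.
by case: eqP => // _; have := hg i j; rewrite mxE.
Qed.

Lemma yields_gs_step n r rs a q (A Q : 'M[R]_(n, r)) j :
  mxholds rs a A -> mxholds rs q Q ->
  yields rs (gs_step_regs a q j) (fun rs' b => mxholds rs' b (gs_step A Q j)).
Proof.
rewrite /gs_step_regs => ha hq.
have haj : mxholds rs (fun i (_ : 'I_1) => a i j) (col j A).
  by move=> i l; rewrite mxE.
apply: yields_bind (yields_const _) _; next zero h0; rewrite rmorph0 in h0.
apply: yields_bind (yields_const _) _; next one h1; rewrite rmorph1 in h1.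
apply: yields_bind (yields_oproj hq haj) _; next w hw.
apply: yields_bind (yields_sqnorm hw) _; next w2 hw2.
apply: yields_bind (yields_leftover h1 hq) _; next c hc.
apply: yields_bind (yields_first_pos _ h0 h1 hc h0) _; next f hf.
apply: yields_bind.
  apply: (yields_tabmx (A := candidate A Q j)) => i l.
  (* [candidate] chooses between vectors while [Select] chooses between scalars, so the test is
     pushed to the entries. *)
  have -> : candidate A Q j i l = if sqnorm (oproj Q (col j A)) <= 0
      then fallback Q i l else col j A i l by rewrite /candidate; case: ifP.
  exact: yields_select.
next x hx; apply: yields_bind (yields_oproj hq hx) _; next y hy.
apply: yields_bind (yields_sqnorm hy) _; next y2 hy2.
apply: yields_bind (yields_sqrt hy2) _; next ny hny.
apply: yields_bind.
  apply: (yields_tabmx (A := (Num.sqrt (sqnorm (oproj Q (candidate A Q j))))^-1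
                             *: oproj Q (candidate A Q j))) => i l.
  by rewrite mxE mulrC; apply: yields_div.
next z hz; apply: yields_ret => rs' le; advance le => i l.
rewrite mxE; case: eqP => _; last exact: hq.
by have := hz i 0; rewrite mxE mulrC.
Qed.

Lemma yields_gram_schmidt n r rs a (A : 'M[R]_(n, r)) : mxholds rs a A ->
  yields rs (gram_schmidt_regs a) (fun rs' b => mxholds rs' b (gram_schmidt A)).
Proof.
rewrite /gram_schmidt_regs.
move=> ha; apply: yields_bind (yields_const _) _; next zero h0.
(* A single register holding 0 stands for all entries of the initial matrix. *)
have hq : mxholds rs0 (fun=> fun=> zero) (0 : 'M[R]_(n, r)).
  by move=> i j; rewrite mxE -(rmorph0 (ratr : rat -> R)).
rewrite /gram_schmidt; elim: (enum _) rs0 (fun=> _) 0 ha hq {h0} => /=.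
  by move=> rs1 q Q _ hq; apply: yields_ret => rs' le; advance le.
move=> j js IHjs rs1 q Q ha hq.
by apply: yields_bind (yields_gs_step j ha hq) _; next q' hq'; apply: IHjs.
Qed.

Lemma yields_power_step n r k m rs u v s d row_of col_of c q
    (U V : 'M[R]_(n, k)) (S : 'rV[R]_k) (D : 'rV[R]_m) x (Q : 'M[R]_(n, r)) :
  mxholds rs u U -> mxholds rs v V -> mxholds rs s S -> mxholds rs d D ->
  holds rs c x -> mxholds rs q Q ->
  yields rs (power_step_regs u v s d row_of col_of c q)
    (fun rs' a => mxholds rs' a
       (power_step (low_rank_plus_sparse U V S D row_of col_of) x Q)).
Proof.
rewrite /power_step_regs.
move=> hu hv hs hd hc hq.
apply: yields_bind (yields_apply _ _ hv hu hs hd hq) _; next yq hyq.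
apply: yields_bind (yields_apply _ _ hu hv hs hd hyq) _; next yyq hyyq.
rewrite /power_step tr_low_rank_plus_sparse.
set Y := low_rank_plus_sparse U _ _ _ _ _ in hyyq *.
set Y' := low_rank_plus_sparse V _ _ _ _ _ in hyq hyyq *.
apply: yields_bind.
  apply: (yields_tabmx (A := Y *m (Y' *m Q) + x *: Q)) => i j.
  apply: yields_bind (yields_mul hc (hq i j)) _; next t ht.
  by rewrite mxE [X in _ + X]mxE; apply: yields_add.
by next b hb; apply: yields_gram_schmidt.
Qed.

Lemma yields_range_finder n r k m rs u v s d row_of col_of tau g N
    (U V : 'M[R]_(n, k)) (S : 'rV[R]_k) (D : 'rV[R]_m) x (G : 'M[R]_(n, r)) :
  mxholds rs u U -> mxholds rs v V -> mxholds rs s S -> mxholds rs d D ->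
  holds rs tau x -> mxholds rs g G ->
  yields rs (range_finder_regs u v s d row_of col_of tau g N)
    (fun rs' a => mxholds rs' a
       (range_finder (low_rank_plus_sparse U V S D row_of col_of) x N G)).
Proof.
rewrite /range_finder_regs.
move=> hu hv hs hd htau hg.
apply: yields_bind (yields_mul htau htau) _; next tau2 htau2.
apply: yields_bind (yields_const _) _; next c hc.
apply: yields_bind (yields_div htau2 hc) _; next shift hshift.
rewrite -expr2 ratr_nat in hshift.
apply: yields_bind (yields_gram_schmidt hg) _; next q hq.
apply: (@yields_iter _ N _ _ _ (fun N rs' a => mxholds rs' a
    (range_finder (low_rank_plus_sparse U V S D row_of col_of) x N G))).
  by move=> N' rs' a le ha; advance le; apply: yields_power_step.
by apply: yields_ret => rs' le; advance le.
Qed.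

Lemma yields_hard_threshold n r k m rs u v s d row_of col_of tau q
    (U V : 'M[R]_(n, k)) (S : 'rV[R]_k) (D : 'rV[R]_m) x (Q : 'M[R]_(n, r)) :
  mxholds rs u U -> mxholds rs v V -> mxholds rs s S -> mxholds rs d D ->
  holds rs tau x -> mxholds rs q Q ->
  let f := threshold_factors svd (x / 8)
             (low_rank_plus_sparse U V S D row_of col_of) Q in
  yields rs (hard_threshold_regs u v s d row_of col_of tau q) (fun rs' y =>
    [/\ mxholds rs' y.1.1 f.1.1, mxholds rs' y.1.2 f.1.2
      & mxholds rs' y.2 f.2]).
Proof.
rewrite /hard_threshold_regs /threshold_factors tr_low_rank_plus_sparse.
move=> hu hv hs hd htau hq.
apply: yields_bind (yields_apply _ _ hv hu hs hd hq) _; next b hb.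
move: (_ *m Q) hb => B hb.
apply: yields_bind (yields_gram_schmidt hb) _; next w hw.
move: (gram_schmidt B) hw => W0 hw.
have hwT : mxholds rs1 (fun l i => w i l) W0^T by move=> i j; rewrite mxE.
apply: yields_bind (yields_mulmx hwT hb) _; next t ht.
have htT : mxholds rs2 (fun i j => t j i) (W0^T *m B)^T.
  by move=> i j; rewrite mxE.
apply: yields_bind (yields_svd htT) _.
move: (svd _) => X.
next y hy; case: hy => hy1 hy2 hy3.
apply: yields_bind (yields_mulmx hq hy1) _; next qu hqu.
apply: yields_bind (yields_mulmx hw hy3) _; next wv hwv.
apply: yields_bind (yields_const _) _; next zero h0; rewrite rmorph0 in h0.
apply: yields_bind (yields_const _) _; next eight h8; rewrite ratr_nat in h8.
apply: yields_bind (yields_div htau h8) _; next lam hlam.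
apply: yields_bind.
  apply: (yields_tabmx (A := threshold (x / 8) X.1.2)) => i l.
  by rewrite mxE ord1; apply: yields_select.
next s' hs'; apply: yields_ret => rs' le; advance le; by split.
Qed.

Lemma yields_misfit n k m rs u v s x row_of col_of (U V : 'M[R]_(n, k))
    (S : 'rV[R]_k) (X : 'rV[R]_m) :
  mxholds rs u U -> mxholds rs v V -> mxholds rs s S -> mxholds rs x X ->
  yields rs (misfit_regs u v s x row_of col_of) (fun rs' e => mxholds rs' e
    (X - \row_l (U *m diag_mx S *m V^T) (row_of l) (col_of l))).
Proof.
move=> hu hv hs hx; apply: yields_tabmx => i l; rewrite !mxE -big_enum.
apply: yields_bind.
  apply: yields_sum => l'; apply: yields_bind (yields_mul (hu _ _) (hs _ _)) _.
  by next t ht; apply: yields_mul ht (hv _ _).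
next z hz; apply: yields_sub => //.
rewrite (eq_bigr (fun l' => U (row_of l) l' * S 0 l' * V (col_of l) l')) //.
by move=> l' _; rewrite mul_mx_diag !mxE.
Qed.

Lemma yields_residual m rs e q (E : 'rV[R]_m) x :
  mxholds rs e E -> holds rs q x ->
  yields rs (residual_regs e q) (fun rs' a => holds rs' a
    (Num.sqrt (\sum_l E 0 l ^+ 2) / Num.sqrt x)).
Proof.
rewrite /residual_regs => he hq; case: eqP => [m0|_].
  rewrite big1 => [|l _]; last by have := ltn_ord l; rewrite [ltnRHS]m0.
  by rewrite sqrtr0 mul0r -(rmorph0 (ratr : rat -> R)); apply: yields_const.
apply: yields_bind.
  by apply: yields_sum => l; apply: yields_mul; apply: he.
next t ht; apply: yields_bind (yields_sqrt ht) _; next a ha.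
apply: yields_bind (yields_sqrt hq) _; next b hb.
rewrite -big_enum (eq_bigr (fun l => E 0 l * E 0 l)) => [|l _].
  exact: yields_div.
exact: expr2.
Qed.

End Correctness.

(** * The complete program and the theorem *)

Section Main.
Context (n r k : nat) (Lam : {set 'I_n * 'I_n}).

Definition row_of (e : 'I_#|Lam|) : 'I_n := (enum_val e).1.
Definition col_of (e : 'I_#|Lam|) : 'I_n := (enum_val e).2.

(** Besides the three factors it returns where the observed misfits and q are stored, so that the
    residual program can read them at no cost. *)
Definition T_regs (N : nat) : @builder (data_index n k #|Lam|) ('I_n * 'I_r)
    (('I_n -> 'I_r -> nat) * ('I_1 -> 'I_r -> nat) * ('I_n -> 'I_r -> nat) *
     (('I_1 -> 'I_#|Lam| -> nat) * nat)) :=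
  bind (emit (Input (@DataQ n k #|Lam|))) (fun q =>
  bind (emit (Input (@DataTau n k #|Lam|))) (fun tau =>
  bind (tabmx (fun i l => emit (Input (DataU #|Lam| i l)))) (fun u =>
  bind (tabmx (fun (_ : 'I_1) l => emit (Input (DataS n #|Lam| l)))) (fun s =>
  bind (tabmx (fun i l => emit (Input (DataV #|Lam| i l)))) (fun v =>
  bind (tabmx (fun (_ : 'I_1) e => emit (Input (DataX n k e)))) (fun x =>
  bind (tabmx (fun i j => emit (Draw (i, j)))) (fun g =>
  bind (misfit_regs u v s x row_of col_of) (fun e =>
  bind (tabmx (fun i l => emit (Div (e i l) q))) (fun d =>
  bind (range_finder_regs u v s d row_of col_of tau g N) (fun b =>
  bind (hard_threshold_regs u v s d row_of col_of tau b) (fun f =>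
  ret (f, (e, q))))))))))))).

(** To the constants 37 and 40 of the two phases come at most 5 m r for the misfits and their
    scaling, and n r for the random draws. *)
Lemma costs_T N : (0 < r)%N -> (k <= r)%N -> (r <= n)%N ->
  costs (T_regs N) (83 * (N.+1 * (#|Lam| * r + n * r ^ 2))).
Proof.
move=> r_gt0 le_kr le_rn; rewrite /T_regs; eapply costs_le.
  count; [exact: costs_misfit | exact: costs_range_finder
    | exact: costs_hard_threshold].
have : (n * r <= n * r ^ 2)%N.
  by rewrite leq_mul2l -{1}[r]expn1 leq_pexp2l ?orbT.
nia.
Qed.

Context {R : realType} (svd : svd_fun (R := R)) (X Z : 'M[R]_n) (q tau : R).
Context (U : 'M[R]_(n, k)) (s : 'rV[R]_k) (V : 'M[R]_(n, k)) (G : 'M[R]_(n, r)).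
Context (ZE : Z = U *m diag_mx s *m V^T).

Definition corrected : 'M[R]_n := Z + q^-1 *: proj_entries Lam (X - Z).

Lemma correctedE :
  corrected = low_rank_plus_sparse U V s
    (q^-1 *: observed_row Lam (X - Z)) row_of col_of.
Proof.
rewrite /corrected ZE; congr (_ + _); rewrite -ZE -sparse_observed.
apply/matrixP=> i j; rewrite !mxE mulr_sumr.
by apply: eq_bigr => e _; rewrite [in RHS]mxE.
Qed.

Lemma yields_T N :
  let f := threshold_factors svd (tau / 8) corrected
             (range_finder corrected tau N G) in
  yields svd (data q tau U s V X) (fun ij => G ij.1 ij.2) [::] (T_regs N)
    (fun rs y => [/\ mxholds rs y.1.1.1 f.1.1, mxholds rs y.1.1.2 f.1.2,
      mxholds rs y.1.2 f.2, mxholds rs y.2.1 (observed_row Lam (X - Z))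
      & holds rs y.2.2 q]).
Proof.
rewrite correctedE /T_regs.
apply: yields_bind (yields_input _) _; next rq hq; rewrite /= in hq.
apply: yields_bind (yields_input _) _; next rtau htau; rewrite /= in htau.
apply: yields_bind.
  by apply: (yields_tabmx (A := U)) => i l; apply: yields_input.
next u hu; apply: yields_bind.
  apply: (yields_tabmx (A := s)) => i l; rewrite ord1; exact: yields_input.
next t hs; apply: yields_bind.
  by apply: (yields_tabmx (A := V)) => i l; apply: yields_input.
next v hv; apply: yields_bind.
  apply: (yields_tabmx (A := observed_row Lam X)) => i e; rewrite mxE.
  exact: yields_input.
next x hx; apply: yields_bind.
  by apply: (yields_tabmx (A := G)) => i j; apply: yields_draw.
next g hg; apply: yields_bind (yields_misfit _ _ hu hv hs hx) _; next e he.
have {}he : mxholds rs6 e (observed_row Lam (X - Z)).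
  by move=> i l; have := he i l; rewrite -ZE !mxE.
apply: yields_bind.
  apply: (yields_tabmx (A := q^-1 *: observed_row Lam (X - Z))) => i l.
  by rewrite mxE mulrC; apply: yields_div.
next d hd.
apply: yields_bind (yields_range_finder _ _ _ hu hv hs hd htau hg) _; next b hb.
apply: yields_bind (yields_hard_threshold _ _ hu hv hs hd htau hb) _; next f hf.
case: hf => hf1 hf2 hf3; apply: yields_ret => rs' le; advance le; by split.
Qed.

End Main.

(** Rounding up and the extra step each add at most 1, and 2 <= (2 / ln 2) ln n because n >= 2. *)
Lemma num_iter_le (R : realType) n : (2 <= n)%N ->
  (num_iter (R := R) n).+1%:R <= (12 + 2 / ln 2) * ln (n%:R : R).
Proof.
move=> n_ge2; have ln2_gt0 : 0 < ln (2 : R) by rewrite ln_gt0 ?ltr1n.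
have ln_le : ln (2 : R) <= ln n%:R.
  by rewrite ler_ln ?posrE ?ltr0n ?ler_nat //; lia.
have ln_ge0 : 0 <= ln (n%:R : R) by apply: le_trans ln_le; apply: ltW.
have lt_ceil := ceilB1_lt (12 * ln (n%:R : R)).
rewrite intrB in lt_ceil.
have le_two : 2 <= 2 / ln 2 * ln (n%:R : R).
  by rewrite mulrAC ler_pdivlMr // ler_wpM2l.
(* The absolute value in [num_iter] is harmless, the ceiling being nonnegative. *)
rewrite -addn1 natrD natr_absz ger0_norm; last first.
  by rewrite ceil_ge0 (lt_le_trans (ltrN10 _)) // mulr_ge0.
by rewrite [leRHS]mulrDl; lra.
Qed.

Theorem proposition2p2 (R : realType) :
  exists C : R,
  forall (n r m k : nat) (Lam : {set 'I_n * 'I_n}),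
    (2 <= n)%N -> (1 <= r)%N -> (r < n)%N -> #|Lam| = m -> (k <= r)%N ->
  exists (main residual : program (data_index n k #|Lam|) ('I_n * 'I_r))
         (out : factored_regs n r) (res : nat),
    [/\ (cost main)%:R <= C * (m * r + n * r ^ 2)%N%:R * ln (n%:R : R),
        (cost residual)%:R <= C * (m * r)%N%:R
      & forall (Xstar Z : 'M[R]_n) (q tau : R)
          (U : 'M[R]_(n, k)) (s : 'rV[R]_k) (V : 'M[R]_(n, k)),
          0 < q -> q <= 1 -> 0 < tau ->
          (\rank Z <= r)%N -> Z = U *m diag_mx s *m V^T ->
        forall svd : svd_fun, svd_correct svd ->
        forall (d : measure_display) (Om : measurableType d)
          (P : probability Om R) (G : Om -> 'M[R]_(n, r)),
          iid_std_gaussian P G ->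
        forall w : Om,
          let exec := run svd (data q tau U s V Xstar)
                          (fun ij => G w ij.1 ij.2) in
          is_T tau (G w) (Z + q^-1 *: proj_entries Lam (Xstar - Z))
            (factored_value out (exec main)) /\
          (exec (main ++ residual))`_res =
            q `^ (- 2^-1) * frobenius (proj_entries Lam (Xstar - Z))].

Proof.
pose C0 : R := 12 + 2 / ln 2.
have ln2_gt0 : 0 < ln (2 : R) by rewrite ln_gt0 ?ltr1n.
have C0_ge : 12 <= C0 by rewrite lerDl divr_ge0 // ltW.
(* 83 comes from [costs_T] and [C0] from [num_iter_le]; the product also exceeds the 5 of the
   residual program. *)
exists (83 * C0) => n r m k Lam n_ge2 r_ge1 lt_rn <- le_kr.
have le_rn := ltnW lt_rn.
pose main := @T_regs n r k Lam (num_iter (R := R) n) 0%N.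
pose out := FactoredRegs (leqnn r) main.2.1.1.1 (main.2.1.1.2 0) main.2.1.2.
(* Generated for the position where the registers of [main] end, so that it can be appended and
   refer back to them. *)
pose residual := @residual_regs (data_index n k #|Lam|) ('I_n * 'I_r)%type
                   _ main.2.2.1 main.2.2.2 (widths main.1).
exists main.1, residual.1, out, residual.2; split.
- have := @costs_T n r k Lam (num_iter (R := R) n) r_ge1 le_kr le_rn 0%N.
  rewrite -(ler_nat R) => /le_trans; apply.
  rewrite 2!natrM -!mulrA ler_wpM2l // [leLHS]mulrC mulrCA ler_wpM2l //.
  exact: num_iter_le.
- have le_cost : (cost residual.1 <= 5 * #|Lam|)%N by apply: costs_residual.
  apply: (@le_trans _ _ (5 * (#|Lam| * r))%N%:R).
    (* The residual program costs only 5 m; r >= 1 turns this into a multiple of m r. *)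
    by rewrite ler_nat (leq_trans le_cost) // mulnA leq_pmulr.
  by rewrite natrM ler_wpM2r //; lra.
move=> X Z q tau U s V q_gt0 _ _ _ ZE svd svdP d Om P G _ w run0.
have := @yields_T n r k Lam R svd X Z q tau U s V (G w) ZE
  (num_iter (R := R) n) _ (prefix_refl _).
rewrite -/main; set f := threshold_factors _ _ _ _.
set rs := exec _ _ _ _ _; case=> hU hS hV hE hq; split.
  suff -> : factored_value out (run0 main.1) = f.1.1 *m diag_mx f.1.2 *m f.2^T.
    exact: is_T_range_finder.
  congr (_ *m _ *m _).
  - by apply/matrixP=> i l; rewrite mxE; apply: (hU i l).2.
  - congr diag_mx; apply/rowP=> l; rewrite mxE; apply: (hS 0 l).2.
  - congr trmx; apply/matrixP=> i l; rewrite mxE; apply: (hV i l).2.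
have := yields_residual (I := data_index n k #|Lam|)
  (W := ('I_n * 'I_r)%type) (svd := svd) (input := data q tau U s V X)
  (sample := fun ij => G w ij.1 ij.2) hE hq (prefix_refl _).
have -> : size rs = widths main.1 by rewrite size_exec.
rewrite -/residual => -[_ res_eq].
have -> : run0 (main.1 ++ residual.1) =
    exec svd (data q tau U s V X) (fun ij => G w ij.1 ij.2) rs residual.1.
  exact: foldl_cat.
rewrite res_eq frobenius_proj_entries powRN powR12_sqrt ?(ltW q_gt0) //.
by rewrite mulrC.
Qed.
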